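(* Let $(X,d)$ be a compact metric space and let $T_1,\dots,T_k\colon X\to X$ ($k\ge2$) be continuous maps such that the set $S_{\mathrm t}$ of weakly hyperbolic sequences of $\mathfrak F=\mathrm{IFS}(T_1,\dots,T_k)$ is non-empty. Let $\mathcal B$ be the Barnsley-Hutchinson operator of $\mathfrak F$, $A_{\mathrm t}$ the target set, and $X^*=\bigcap_{n\ge0}\mathcal B^n(X)$. Then the following three assertions are equivalent: (1) $\overline{A_{\mathrm t}}=X^*$; (2) the operator $\mathcal B$ has a unique fixed point; (3) $X^*$ is a global attractor of $\mathfrak F$.
   Context: $\mathrm{IFS}(T_1,\dots,T_k)$ denotes the iterated function system formed by the continuous maps $T_1,\dots,T_k$ of $X$. Its Barnsley-Hutchinson operator is $\mathcal B(A)=\bigcup_{i=1}^k T_i(A)$ for $A\subset X$. $\mathcal H(X)$ is the set of non-empty compact subsets of $X$ with the Hausdorff distance; limits of compact sets are taken in this distance. A fixed point of $\mathcal B$ means a set $K\in\mathcal H(X)$ with $\mathcal B(K)=K$. $\Sigma_k^+=\{1,\dots,k\}^{\mathbb N}$. The set of weakly hyperbolic sequences is $S_{\mathrm t}=\{\xi\in\Sigma_k^+ : \lim_{n\to\infty}\mathrm{diam}(T_{\xi_0}\circ\cdots\circ T_{\xi_n}(X))=0\}$. The coding map $\pi\colon S_{\mathrm t}\to X$ is $\pi(\xi)=\lim_{n\to\infty}T_{\xi_0}\circ\cdots\circ T_{\xi_n}(p)$, which does not depend on $p\in X$. The target set is $A_{\mathrm t}=\pi(S_{\mathrm t})$. A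 set $A\in\mathcal H(X)$ is a strict attractor if there is an open neighbourhood $U$ of $A$ such that $\lim_{n\to\infty}\mathcal B^n(K)=A$ for every non-empty compact $K\subset U$. A global attractor is a strict attractor whose basin of attraction is $X$, i.e. $\lim_{n\to\infty}\mathcal B^n(K)=A$ for every $K\in\mathcal H(X)$. *)

(* Defs.v *)
From HB Require Import structures.
From mathcomp Require Import all_boot all_order all_algebra.
From mathcomp Require Import all_classical all_reals all_analysis.

Set Implicit Arguments.
Unset Strict Implicit.
Unset Printing Implicit Defensive.

Import Order.TTheory GRing.Theory Num.Theory.

Local Open Scope classical_set_scope.
Local Open Scope ring_scope.

(* Suprema and infima of distances are taken in \bar R, so no boundedness
   assumption is hidden in them; they are only applied to non-empty sets. *)

Definition diam (R : realType) (X : metricType R) (A : set X) : \bar R :=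
  ereal_sup [set (mdist xy.1 xy.2)%:E | xy in A `*` A].

Definition dist_to_set (R : realType) (X : metricType R) (x : X) (A : set X) :
    \bar R :=
  ereal_inf [set (mdist x a)%:E | a in A].

Definition hausdorff_dist (R : realType) (X : metricType R) (A B : set X) :
    \bar R :=
  maxe (ereal_sup [set dist_to_set a B | a in A])
       (ereal_sup [set dist_to_set b A | b in B]).

(* Membership in the hyperspace H(X). *)
Definition hyperspace (X : topologicalType) (A : set X) : Prop :=
  A !=set0 /\ compact A.

Definition hutchinson (X : Type) (k : nat) (T : 'I_k -> X -> X) (A : set X) :
    set X :=
  \bigcup_i (T i @` A).

Definition fixed_point (X : topologicalType) (k : nat) (T : 'I_k -> X -> X)
    (K : set X) : Prop :=
  hyperspace K /\ hutchinson T K = K.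

Definition Xstar (X : Type) (k : nat) (T : 'I_k -> X -> X) : set X :=
  \bigcap_n iter n (hutchinson T) [set: X].

(* T_(xi 0) \o ... \o T_(xi n), with n + 1 factors. *)
Fixpoint branch (X : Type) (k : nat) (T : 'I_k -> X -> X) (xi : nat -> 'I_k)
    (n : nat) : X -> X :=
  if n is m.+1 then branch T xi m \o T (xi n) else T (xi 0%N).

Definition weakly_hyperbolic (R : realType) (X : metricType R) (k : nat)
    (T : 'I_k -> X -> X) : set (nat -> 'I_k) :=
  [set xi | diam (branch T xi n @` [set: X]) @[n --> \oo] --> 0%E].

(* The limit of branch T xi n p, i.e. the library's lim unfolded, because
   metricType is not pointed. The base point p is also the junk value when there
   is no limit, which does not happen for weakly hyperbolic xi in a compact X. *)
Definition coding_map (R : realType) (X : metricType R) (k : nat)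
    (T : 'I_k -> X -> X) (p : X) (xi : nat -> 'I_k) : X :=
  xget p [set x | branch T xi n p @[n --> \oo] --> x].

Definition target_set (R : realType) (X : metricType R) (k : nat)
    (T : 'I_k -> X -> X) (p : X) : set X :=
  coding_map T p @` weakly_hyperbolic T.

Definition attracts (R : realType) (X : metricType R) (k : nat)
    (T : 'I_k -> X -> X) (A K : set X) : Prop :=
  hausdorff_dist (iter n (hutchinson T) K) A @[n --> \oo] --> 0%E.

Definition strict_attractor (R : realType) (X : metricType R) (k : nat)
    (T : 'I_k -> X -> X) (A : set X) : Prop :=
  hyperspace A /\
  exists U : set X, [/\ open U, A `<=` U &
    forall K : set X, hyperspace K -> K `<=` U -> attracts T A K].

Definition global_attractor (R : realType) (X : metricType R) (k : nat)
    (T : 'I_k -> X -> X) (A : set X) : Prop :=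
  strict_attractor T A /\ forall K : set X, hyperspace K -> attracts T A K.

(* Main.v *)
Require Import Defs.
From HB Require Import structures.
From mathcomp Require Import all_boot all_order all_algebra.
From mathcomp Require Import all_classical all_reals all_analysis.
From mathcomp Require Import lra.

Set Implicit Arguments.
Unset Strict Implicit.
Unset Printing Implicit Defensive.

Import Order.TTheory GRing.Theory Num.Theory.

Local Open Scope classical_set_scope.
Local Open Scope ring_scope.

(** The closure of the target set is the least fixed point of the operator and
    X* is the greatest one; everything follows from this.

    X* is fixed because, for y in X*, the closed sets of the points of B^n(X)
    that some T_i maps to y are nested and non-empty, so compactness gives such
    a point in X* ([Xstar_fixed_point]). It is the greatest fixed point since
    K = B^n(K) is contained in B^n(X).

    A sequence xi is weakly hyperbolic exactly when the nested compact sets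
    T_(xi 0) \o ... \o T_(xi n) (X) enter every neighbourhood of one point x,
    and then the coding map sends xi to x ([diam_cvg0P], [target_setE]). In this
    form, diameters and uniform continuity disappear: continuity of T_i at x
    alone shows that the coding map sends xi with i put in front to T_i x, so
    the target set is forward invariant. Evaluating the branches at a point of
    a closed forward invariant set K <> {} shows that K contains the target
    set ([target_sub_invariant]). Applied to K = B(cl A_t), this yields the
    inclusion of cl A_t in B(cl A_t), which makes cl A_t a fixed point. One
    cannot argue by shifting xi instead: the shift of a weakly hyperbolic
    sequence may fail to be weakly hyperbolic (T_(xi 0) may be constant).

    Hence the fixed point is unique iff the least and the greatest one agree,
    that is, iff cl A_t = X*. A global attractor is at Hausdorff distance 0 from
    every fixed point, so its existence implies uniqueness. Finally, for every K
    the set B^n(K) lies in B^n(X), hence near X*; and near each point of the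
    target set it eventually has a point, namely the value of a branch at a
    point of K. When cl A_t = X*, compactness of X* makes the latter uniform, so
    that B^n(K) tends to X* ([closure_target_global]). *)

(** * Nested closed sets in a compact space *)

Lemma nonincreasing_sets (X : Type) (C : nat -> set X) :
  (forall n, C n.+1 `<=` C n) ->
  forall m n, (m <= n)%N -> C n `<=` C m.
Proof.
move=> CS m n /subnK <-; elim: (n - m)%N => [//|d IHd].
by rewrite addSn; exact: subset_trans (CS _) IHd.
Qed.

(** Every point has a neighbourhood that either lies in U or is avoided by all
    C n with n large; compactness makes the threshold on n uniform. *)
Lemma nested_closed_near_sub (X : topologicalType) (C : nat -> set X)
    (U : set X) :
  compact [set: X] -> (forall n, closed (C n)) ->
  (forall n, C n.+1 `<=` C n) -> open U -> \bigcap_n C n `<=` U ->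
  \forall n \near \oo, C n `<=` U.
Proof.
move=> /compact_near_coveringP cX cC /nonincreasing_sets CS oU CU.
have [|N _ HN] := cX _ _ (fun n x => C n x -> U x) eventually_filter.
  move=> x _; have [Ux|nUx] := pselect (U x).
    near=> y n => /= _; near: y.
    exact: open_nbhs_nbhs.
  have [m nCm] : exists m, ~ C m x.
    apply: contra_notP nUx => /forallNP CN; apply: CU => n _.
    exact: contrapT (CN n).
  near=> y n => /= Cny.
  have : (~` C m) y.
    by near: y; apply: open_nbhs_nbhs; split=> //; exact: closed_openC.
  by case; apply: CS Cny; near: n; exact: nbhs_infty_ge.
exists N => // n Nn x; exact: HN.
Unshelve. all: by end_near. Qed.

Lemma nested_closed_nonempty (X : topologicalType) (C : nat -> set X) :
  compact [set: X] -> (forall n, closed (C n)) ->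
  (forall n, C n.+1 `<=` C n) -> (forall n, C n !=set0) ->
  \bigcap_n C n !=set0.
Proof.
move=> cX cC CS C0; apply: contrapT => /nonemptyPn capC0.
have [|N _ /(_ N (leqnn N))] := nested_closed_near_sub cX cC CS (@open0 X).
  by rewrite capC0.
by have [x Cx] := C0 N => /(_ x Cx).
Qed.

(** * Extended real distances *)

Lemma cvge0P (R : realType) (f : nat -> \bar R) :
  (forall n, (0 <= f n)%E) ->
  f n @[n --> \oo] --> 0%E <->
  forall e, 0 < e -> \forall n \near \oo, (f n <= e%:E)%E.
Proof.
move=> f0; split=> [/fine_cvgP[ffin /cvgrPdist_le fe] e e0|fe].
  near=> n; have fn : f n \is a fin_num by near: n.
  rewrite -(fineK fn) lee_fin.
  have : `|0 - fine (f n)| <= e by near: n; exact: fe.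
  by rewrite sub0r normrN ger0_norm// fine_ge0.
have ffin : \forall n \near \oo, f n \is a fin_num.
  near=> n; rewrite ge0_fin_numE//; apply: le_lt_trans (ltry 1).
  by near: n; exact: fe.
apply/fine_cvgP; split=> //; apply/cvgrPdist_le => e e0; near=> n.
have fn : f n \is a fin_num by near: n.
rewrite sub0r normrN ger0_norm ?fine_ge0// -lee_fin fineK//.
by near: n; exact: fe.
Unshelve. all: by end_near. Qed.

Lemma diam_ge0 (R : realType) (X : metricType R) (A : set X) :
  A !=set0 -> (0 <= diam A)%E.
Proof.
move=> [a Aa]; apply: ereal_sup_ubound; exists (a, a) => //=.
by rewrite mdistxx.
Qed.

Lemma dist_to_set_ge0 (R : realType) (X : metricType R) (x : X) (A : set X) :
  (0 <= dist_to_set x A)%E.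
Proof. by apply: le_ereal_inf_tmp => _ [a _ <-]; rewrite lee_fin mdist_ge0. Qed.

Lemma hausdorff_dist_ge0 (R : realType) (X : metricType R) (A B : set X) :
  A !=set0 -> (0 <= hausdorff_dist A B)%E.
Proof.
move=> [a Aa]; rewrite /hausdorff_dist le_max; apply/orP; left.
by apply: le_trans (dist_to_set_ge0 a B) _; apply: ereal_sup_ubound; exists a.
Qed.

Lemma hausdorff_dist_le (R : realType) (X : metricType R) (A B : set X)
    (e : R) :
  (forall a, A a -> exists2 b, B b & mdist a b <= e) ->
  (forall b, B b -> exists2 a, A a & mdist b a <= e) ->
  (hausdorff_dist A B <= e%:E)%E.
Proof.
move=> AB BA; rewrite /hausdorff_dist ge_max; apply/andP; split;
  apply: ge_ereal_sup => _ [x /[dup] Hx + <-].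
- move=> /AB[b Bb]; rewrite -lee_fin; apply: le_trans.
  by apply: ereal_inf_lbound; exists b.
- move=> /BA[b Bb]; rewrite -lee_fin; apply: le_trans.
  by apply: ereal_inf_lbound; exists b.
Qed.

Lemma dist_to_set_le0 (R : realType) (X : metricType R) (x : X) (A : set X) :
  (dist_to_set x A <= 0)%E -> closure A x.
Proof.
move=> xA0 U /nbhs_ballP[e /= e0 xeU].
have /ereal_inf_lt[_ [a Aa <-]] : (dist_to_set x A < e%:E)%E.
  by apply: le_lt_trans xA0 _; rewrite lte_fin.
by rewrite lte_fin => xae; exists a; split=> //; apply: xeU; rewrite ballEmdist.
Qed.

Lemma hausdorff_dist_le0_eq (R : realType) (X : metricType R) (A B : set X) :
  closed A -> closed B -> (hausdorff_dist A B <= 0)%E -> A = B.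
Proof.
move=> cA cB; rewrite /hausdorff_dist ge_max => /andP[sA sB].
apply/seteqP; split=> x Hx.
- rewrite (closure_id B).1//; apply: dist_to_set_le0; apply: le_trans sA.
  by apply: ereal_sup_ubound; exists x.
- rewrite (closure_id A).1//; apply: dist_to_set_le0; apply: le_trans sB.
  by apply: ereal_sup_ubound; exists x.
Qed.

(** * Nested sets that shrink to a point *)

Definition shrinks_to (X : topologicalType) (C : nat -> set X) (x : X) : Prop :=
  forall U, nbhs x U -> \forall n \near \oo, C n `<=` U.

(** The point is a common element of the C n, which exists by compactness. The
    right-hand side is topological, and continuous maps visibly preserve it. *)
Lemma diam_cvg0P (R : realType) (X : metricType R) (C : nat -> set X) :
  compact [set: X] -> (forall n, closed (C n)) ->
  (forall n, C n.+1 `<=` C n) -> (forall n, C n !=set0) ->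
  diam (C n) @[n --> \oo] --> 0%E <-> exists x, shrinks_to C x.
Proof.
move=> cX cC CS C0; have d0 n : (0 <= diam (C n))%E by exact: diam_ge0.
split=> [/(cvge0P d0) dC|[x Cx]].
  have [x capCx] := nested_closed_nonempty cX cC CS C0.
  exists x => U /nbhs_ballP[e /= e0 xeU].
  have [|N _ HN] := dC (e / 2); first by rewrite divr_gt0.
  exists N => // n /HN dn y Cny; apply: xeU; rewrite ballEmdist /=.
  apply: (@le_lt_trans _ _ (e / 2)).
    2: by rewrite ltr_pdivrMr// ltr_pMr ?ltr1n.
  rewrite -lee_fin; apply: le_trans dn; apply: ereal_sup_ubound.
  by exists (x, y) => //; split=> //; exact: capCx.
apply/(cvge0P d0) => e e0; have e20 : 0 < e / 2 by rewrite divr_gt0.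
have := Cx _ (nbhsx_ballx x (e / 2) e20); apply: filterS => n Cn.
apply: ge_ereal_sup => _ [[y z] [/Cn + /Cn +] <-] /=.
rewrite !ballEmdist /= lee_fin => xy xz.
rewrite (le_trans (metric_triangle _ x _))// metric_sym [leRHS]splitr.
by rewrite lerD// ltW.
Qed.

(** * Iterates of the Barnsley-Hutchinson operator *)

Lemma hutchinson_mono (X : Type) (k : nat) (T : 'I_k -> X -> X) (A B : set X) :
  A `<=` B -> hutchinson T A `<=` hutchinson T B.
Proof. by move=> AB; apply: subset_bigcup => i _; exact: image_subset. Qed.

Lemma iter_hutchinson_mono (X : Type) (k : nat) (T : 'I_k -> X -> X)
    (A B : set X) n :
  A `<=` B -> iter n (hutchinson T) A `<=` iter n (hutchinson T) B.
Proof. by move=> AB; elim: n => [//|n IHn]; exact: hutchinson_mono. Qed.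

Lemma iter_hutchinson_fixed (X : Type) (k : nat) (T : 'I_k -> X -> X)
    (K : set X) n : hutchinson T K = K -> iter n (hutchinson T) K = K.
Proof. by move=> BK; elim: n => //= n ->. Qed.

Lemma iter_hutchinson_nonincreasing (X : Type) (k : nat)
    (T : 'I_k -> X -> X) n :
  iter n.+1 (hutchinson T) [set: X] `<=` iter n (hutchinson T) [set: X].
Proof. by rewrite iterSr; exact: iter_hutchinson_mono. Qed.

(** The innermost map of a branch acts first, so it is the one absorbed by the
    first application of the operator to A. *)
Lemma branch_iter_hutchinson (X : Type) (k : nat) (T : 'I_k -> X -> X)
    (xi : nat -> 'I_k) (A : set X) n q :
  A q -> iter n.+1 (hutchinson T) A (branch T xi n q).
Proof.
elim: n A q => [|n IHn] A q Aq; first by exists (xi 0%N) => //; exists q.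
rewrite iterSr /=; apply: IHn.
by exists (xi n.+1) => //; exists q.
Qed.

Lemma hutchinson_nonempty (X : Type) (k : nat) (T : 'I_k -> X -> X) (i : 'I_k)
    (A : set X) : A !=set0 -> hutchinson T A !=set0.
Proof. by move=> [a Aa]; exists (T i a), i => //; exists a. Qed.

Lemma iter_hutchinson_nonempty (X : Type) (k : nat) (T : 'I_k -> X -> X)
    (i : 'I_k) (A : set X) n : A !=set0 -> iter n (hutchinson T) A !=set0.
Proof. by move=> A0; elim: n => //= n; exact: hutchinson_nonempty. Qed.

(** * The greatest fixed point *)

Lemma image_closed (R : realType) (X : metricType R) (f : X -> X) (A : set X) :
  compact [set: X] -> continuous f -> closed A -> closed (f @` A).
Proof.
move=> cX cf cA; apply: compact_closed; first exact: metric_hausdorff.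
apply: continuous_compact; first exact: continuous_subspaceT.
exact: subclosed_compact cA cX _.
Qed.

Lemma hutchinson_closed (R : realType) (X : metricType R) (k : nat)
    (T : 'I_k -> X -> X) (A : set X) :
  compact [set: X] -> (forall i, continuous (T i)) -> closed A ->
  closed (hutchinson T A).
Proof.
move=> cX cT cA; apply: closed_bigcup => [|i _]; first exact: finite_finset.
exact: image_closed.
Qed.

Lemma iter_hutchinson_closed (R : realType) (X : metricType R) (k : nat)
    (T : 'I_k -> X -> X) (A : set X) n :
  compact [set: X] -> (forall i, continuous (T i)) -> closed A ->
  closed (iter n (hutchinson T) A).
Proof. by move=> cX cT cA; elim: n => //= n; exact: hutchinson_closed. Qed.

Lemma Xstar_closed (R : realType) (X : metricType R) (k : nat)
    (T : 'I_k -> X -> X) :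
  compact [set: X] -> (forall i, continuous (T i)) -> closed (Xstar T).
Proof.
by move=> cX cT; apply: closed_bigI => n _; apply: iter_hutchinson_closed.
Qed.

Lemma Xstar_fixed_point (R : realType) (X : metricType R) (k : nat)
    (T : 'I_k -> X -> X) (i : 'I_k) (p : X) :
  compact [set: X] -> (forall i, continuous (T i)) -> fixed_point T (Xstar T).
Proof.
move=> cX cT.
have cB n : closed (iter n (hutchinson T) [set: X]).
  exact: iter_hutchinson_closed.
have BS n :
    iter n.+1 (hutchinson T) [set: X] `<=` iter n (hutchinson T) [set: X].
  exact: iter_hutchinson_nonincreasing.
split.
  split; last exact: subclosed_compact (Xstar_closed cX cT) cX _.
  apply: nested_closed_nonempty => // n.
  by apply: iter_hutchinson_nonempty => //; exists p.
apply/seteqP; split=> y.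
  move=> [j _ [x Xx <-]] [//|n] _; exists j => //; exists x => //; exact: Xx.
(* The preimages of y in B^n(X) form nested closed sets; y lies in B^(n+1)(X),
   so they are non-empty, and a common point is a preimage of y in X*. *)
move=> Xy; pose F := \bigcup_j T j @^-1` [set y].
have cF : closed F.
  apply: closed_bigcup => [|j _]; first exact: finite_finset.
  apply: closed_comp => [x _|]; first exact: cT.
  exact/accessible_closed_set1/hausdorff_accessible/metric_hausdorff.
have [|||x capx] := @nested_closed_nonempty _
  (fun n => iter n (hutchinson T) [set: X] `&` F) cX.
- by move=> n; exact: closedI.
- by move=> n; exact: setSI.
- move=> n; have [j _ [x Bx Txy]] := Xy n.+1 I.
  by exists x; split=> //; exists j.
have [_ [j _ Txy]] := capx 0%N I; exists j => //; exists x => // n _.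
by have [] := capx n I.
Qed.

Lemma fixed_sub_Xstar (X : Type) (k : nat) (T : 'I_k -> X -> X) (K : set X) :
  hutchinson T K = K -> K `<=` Xstar T.
Proof.
move=> BK x Kx n _; rewrite -(iter_hutchinson_fixed n BK) in Kx.
exact: iter_hutchinson_mono Kx.
Qed.

(** * The target set and its closure *)

Lemma branch_continuous (X : topologicalType) (k : nat) (T : 'I_k -> X -> X)
    (xi : nat -> 'I_k) n :
  (forall i, continuous (T i)) -> continuous (branch T xi n).
Proof.
move=> cT; elim: n => [|n IHn] x /=; first exact: cT.
by apply: continuous_comp; [exact: cT|exact: IHn].
Qed.

Lemma branch_image_nonincreasing (X : Type) (k : nat) (T : 'I_k -> X -> X)
    (xi : nat -> 'I_k) n :
  branch T xi n.+1 @` [set: X] `<=` branch T xi n @` [set: X].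
Proof. by move=> _ [x _ <-]; exists (T (xi n.+1) x). Qed.

Definition scons (I : Type) (i : I) (xi : nat -> I) : nat -> I :=
  fun n => if n is m.+1 then xi m else i.

Lemma branch_scons (X : Type) (k : nat) (T : 'I_k -> X -> X) i
    (xi : nat -> 'I_k) n x :
  branch T (scons i xi) n.+1 x = T i (branch T xi n x).
Proof. by elim: n x => [//|n IHn] x; rewrite [LHS]IHn. Qed.

(** In a compact space, xi is weakly hyperbolic and x is its image under the
    coding map, said without diameters and without a base point. *)
Definition codes (X : topologicalType) (k : nat) (T : 'I_k -> X -> X)
    (xi : nat -> 'I_k) (x : X) : Prop :=
  shrinks_to (fun n => branch T xi n @` [set: X]) x.

Lemma codes_cvg (X : topologicalType) (k : nat) (T : 'I_k -> X -> X)
    (xi : nat -> 'I_k) (x q : X) :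
  codes T xi x -> branch T xi n q @[n --> \oo] --> x.
Proof.
by move=> xix U /xix; apply: filterS => n; apply; exists q.
Qed.

Lemma target_setE (R : realType) (X : metricType R) (k : nat)
    (T : 'I_k -> X -> X) (p : X) :
  compact [set: X] -> (forall i, continuous (T i)) ->
  target_set T p = [set x | exists xi, codes T xi x].
Proof.
move=> cX cT.
have whP xi : weakly_hyperbolic T xi <-> exists x, codes T xi x.
  apply: diam_cvg0P => // n; last by exists (branch T xi n p), p.
  - by apply: image_closed => //; exact: branch_continuous.
  - exact: branch_image_nonincreasing.
have cmE xi x : codes T xi x -> coding_map T p xi = x.
  move=> /(@codes_cvg _ _ _ _ _ p) xix; apply: xget_unique => // y xiy.
  by apply: cvg_unique xiy xix; exact: metric_hausdorff.
apply/seteqP; split=> x.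
  by move=> [xi /whP[y xiy] <-]; exists xi; rewrite (cmE _ _ xiy).
by move=> [xi xix]; exists xi; [apply/whP; exists x|exact: cmE].
Qed.

(** Prepending i replaces each branch image by its image under T i, so that only
    continuity at the point coded by xi matters. *)
Lemma codes_scons (X : topologicalType) (k : nat) (T : 'I_k -> X -> X) i
    (xi : nat -> 'I_k) (x : X) :
  {for x, continuous (T i)} -> codes T xi x -> codes T (scons i xi) (T i x).
Proof.
move=> cTi xix U /cTi /xix [N _ HN]; exists N.+1 => // -[//|n] Nn _ [q _ <-].
by rewrite branch_scons; apply: (HN n Nn); exists q.
Qed.

Lemma hutchinson_target_sub (R : realType) (X : metricType R) (k : nat)
    (T : 'I_k -> X -> X) (p : X) :
  compact [set: X] -> (forall i, continuous (T i)) ->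
  hutchinson T (target_set T p) `<=` target_set T p.
Proof.
move=> cX cT; rewrite target_setE// => _ [i _ [x [xi xix] <-]].
by exists (scons i xi); apply: codes_scons => //; exact: cT.
Qed.

(** The coding map does not depend on the base point, which may therefore be
    taken in K; the branches then stay in K. *)
Lemma target_sub_invariant (R : realType) (X : metricType R) (k : nat)
    (T : 'I_k -> X -> X) (p : X) (K : set X) :
  compact [set: X] -> (forall i, continuous (T i)) ->
  closed K -> K !=set0 -> hutchinson T K `<=` K -> target_set T p `<=` K.
Proof.
move=> cX cT cK [q Kq] BK; rewrite target_setE// => x [xi /codes_cvg xix].
apply: (closed_cvg K cK _ _ (xix q)); apply: nearW => n.
suff itK m : iter m (hutchinson T) K `<=` K.
  exact/(itK n.+1)/branch_iter_hutchinson.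
elim: m => [//|m IHm] y; move=> /(hutchinson_mono IHm); exact: BK.
Qed.

(** Invariance of closure A passes to B (closure A), which is again closed and
    forward invariant, hence contains the target set A by minimality. *)
Lemma closure_target_fixed_point (R : realType) (X : metricType R) (k : nat)
    (T : 'I_k -> X -> X) (p : X) :
  compact [set: X] -> (forall i, continuous (T i)) ->
  weakly_hyperbolic T !=set0 -> fixed_point T (closure (target_set T p)).
Proof.
move=> cX cT [xi Sxi]; set A := target_set T p.
have A0 : closure A !=set0.
  by exists (coding_map T p xi); apply: subset_closure; exists xi.
have cA : closed (closure A) by exact: closed_closure.
have BA : hutchinson T (closure A) `<=` closure A.
  move=> _ [i _ [x Ax <-]] U /cT /Ax [y [Ay Uy]].
  exists (T i y); split=> //; apply: hutchinson_target_sub => //.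
  by exists i => //; exists y.
split; first by split=> //; exact: subclosed_compact cA cX _.
apply/seteqP; split=> //.
have cB : closed (hutchinson T (closure A)) by exact: hutchinson_closed.
rewrite [X in _ `<=` X](closure_id _).1//; apply: closure_subset.
apply: target_sub_invariant => //; last exact: hutchinson_mono.
exact: hutchinson_nonempty (xi 0%N) _ A0.
Qed.

(** * Attraction *)

(** The open e-neighbourhood of X* contains the intersection of the nested
    closed sets B^n(X), hence all but finitely many of them. *)
Lemma near_iter_Xstar (R : realType) (X : metricType R) (k : nat)
    (T : 'I_k -> X -> X) (e : R) :
  compact [set: X] -> (forall i, continuous (T i)) -> 0 < e ->
  \forall n \near \oo, forall a, iter n (hutchinson T) [set: X] a ->
    exists2 b, Xstar T b & mdist a b < e.
Proof.
move=> cX cT e0; pose U := \bigcup_(b in Xstar T) (ball b e)°.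
have [||||N _ HN] := @nested_closed_near_sub X
    (fun n => iter n (hutchinson T) [set: X]) U cX.
- by move=> n; apply: iter_hutchinson_closed.
- exact: iter_hutchinson_nonincreasing.
- by apply: bigcup_open => b _; exact: open_interior.
- by move=> b Xb; exists b => //; exact: nbhsx_ballx.
exists N => // n Nn a /(HN n Nn)[b Xb /interior_subset].
by rewrite ballEmdist /= metric_sym => ab; exists b.
Qed.

(** A point b of the closure is close to some x coded by a sequence xi, and the
    branches of xi send any q in K to points of the iterates of K that approach
    x. The same points serve all y near b, and compactness of the closure gives
    a bound on n that is valid for all b. *)
Lemma near_iter_closure_target (R : realType) (X : metricType R) (k : nat)
    (T : 'I_k -> X -> X) (p : X) (K : set X) (e : R) :
  compact [set: X] -> (forall i, continuous (T i)) -> K !=set0 -> 0 < e ->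
  \forall n \near \oo, forall b, closure (target_set T p) b ->
    exists2 a, iter n (hutchinson T) K a & mdist b a < e.
Proof.
move=> cX cT [q Kq] e0; rewrite target_setE//; set A := [set x | _].
have /compact_near_coveringP cA : compact (closure A).
  by apply: subclosed_compact cX _ => //; exact: closed_closure.
have e30 : 0 < e / 3 by rewrite divr_gt0.
have [|N _ HN] := cA _ _ (fun n b => exists2 a,
    iter n (hutchinson T) K a & mdist b a < e) eventually_filter.
  move=> b /(_ _ (nbhsx_ballx b (e / 3) e30))[x [[xi xix] bx]].
  have nearx := xix _ (nbhsx_ballx x (e / 3) e30).
  near=> y n => /=.
  (* A branch of index m has m + 1 factors, whence the index n.-1. *)
  have n0 : (0 < n)%N by near: n; exact: nbhs_infty_gt.
  exists (branch T xi n.-1 q).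
    by rewrite -{1}(prednK n0); exact: branch_iter_hutchinson.
  have : ball x (e / 3) (branch T xi n.-1 q).
    suff /(_ (branch T xi n.-1 q)) :
        branch T xi n.-1 @` [set: X] `<=` ball x (e / 3) by apply; exists q.
    near: n; case: nearx => N _ HN; exists N.+1 => // m Nm.
    by apply: HN; rewrite /= -ltnS prednK// (leq_trans _ Nm).
  have : ball b (e / 3) y by near: y; exact: nbhsx_ballx.
  move: bx; rewrite !ballEmdist /= => bx b_y xq.
  apply: le_lt_trans (metric_triangle _ b _) _.
  apply: le_lt_trans (lerD (lexx _) (metric_triangle _ x _)) _.
  by rewrite metric_sym; lra.
by exists N => // n Nn b; exact: HN.
Unshelve. all: by end_near. Qed.

Lemma closure_target_global (R : realType) (X : metricType R) (k : nat)
    (T : 'I_k -> X -> X) (p : X) :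
  compact [set: X] -> (forall i, continuous (T i)) ->
  fixed_point T (Xstar T) -> closure (target_set T p) = Xstar T ->
  global_attractor T (Xstar T).
Proof.
move=> cX cT [XsH BXs] clA.
suff glob K : hyperspace K -> attracts T (Xstar T) K.
  split=> //; split=> //; exists setT; split=> //; first exact: openT.
  by move=> K /glob.
move=> [K0 _].
have [i _] : exists i : 'I_k, True.
  by case: XsH => -[x]; rewrite -BXs => -[i _ _] _; exists i.
apply/cvge0P => [n|e e0].
  by apply: hausdorff_dist_ge0; exact: iter_hutchinson_nonempty.
have H1 := near_iter_Xstar cX cT e0.
have H2 := near_iter_closure_target p cX cT K0 e0.
near=> n; apply: hausdorff_dist_le.
- move=> a Ka.
  have Xa : iter n (hutchinson T) [set: X] a.
    exact: iter_hutchinson_mono (@subsetT _ _) _ Ka.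
  suff /(_ a Xa)[b Xb /ltW ab] : forall a, iter n (hutchinson T) [set: X] a ->
      exists2 b, Xstar T b & mdist a b < e by exists b.
  by near: n.
- move=> b Xb.
  suff /(_ b)[|a Ka /ltW ba] : forall b, closure (target_set T p) b ->
      exists2 a, iter n (hutchinson T) K a & mdist b a < e.
  + by rewrite clA.
  + by exists a.
  + by near: n.
Unshelve. all: by end_near. Qed.

(** The iterates of a fixed point K are constant, so their convergence to A
    means that K and A are at Hausdorff distance 0. *)
Lemma global_attractor_fixed_point_eq (R : realType) (X : metricType R)
    (k : nat) (T : 'I_k -> X -> X) (A K : set X) :
  global_attractor T A -> fixed_point T K -> K = A.
Proof.
move=> [[[A0 cA] _] glob] [[K0 cK] BK].
apply: hausdorff_dist_le0_eq; [| |apply/lee_addgt0Pr => e e0; rewrite add0e].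
- by apply: compact_closed cK; exact: metric_hausdorff.
- by apply: compact_closed cA; exact: metric_hausdorff.
have : attracts T A K by exact: glob.
have BnK n : iter n (hutchinson T) K = K by exact: iter_hutchinson_fixed.
rewrite /attracts; under eq_fun do rewrite BnK.
move=> /(cvge0P (fun=> hausdorff_dist_ge0 _ K0)) /(_ e e0)[N _ /(_ N)].
by apply => /=.
Qed.

(* The base point p of the coding map is arbitrary; its presence also records
   that X is non-empty. *)
Theorem theorem2 (R : realType) (X : metricType R) (k : nat)
    (T : 'I_k -> X -> X) (p : X)
    (hX : compact [set: X])
    (hk : (2 <= k)%N)
    (hT : forall i : 'I_k, continuous (T i))
    (hS : weakly_hyperbolic T !=set0) :
  (closure (target_set T p) = Xstar T <->
     exists! K : set X, fixed_point T K) /\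
  ((exists! K : set X, fixed_point T K) <->
     global_attractor T (Xstar T)).
Proof.
have clA_fix := closure_target_fixed_point p hX hT hS.
have Xs_fix : fixed_point T (Xstar T).
  by case: hS => xi _; exact: Xstar_fixed_point (xi 0%N) p hX hT.
have unique_eq : (exists! K : set X, fixed_point T K) ->
    closure (target_set T p) = Xstar T.
  by move=> [K [_ Kuniq]]; rewrite -(Kuniq _ clA_fix) -(Kuniq _ Xs_fix).
have eq_unique : closure (target_set T p) = Xstar T ->
    exists! K : set X, fixed_point T K.
  move=> clA; exists (Xstar T); split=> // K [[K0 cK] BK].
  have clK : closed K by apply: compact_closed cK; exact: metric_hausdorff.
  apply/seteqP; split; last exact: fixed_sub_Xstar.
  rewrite -clA [X in _ `<=` X](closure_id K).1//; apply: closure_subset.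
  by apply: target_sub_invariant => //; rewrite BK.
split; first by split.
split=> [/unique_eq|glob]; first exact: closure_target_global.
by exists (Xstar T); split=> // K /(global_attractor_fixed_point_eq glob).
Qed.
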